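(* Let $M$ be a real symmetric matrix of order $n$, with distinct main eigenvalues $\lambda_1,\ldots,\lambda_r$, and let $\beta_i$ be the main angle of $\lambda_i$ for $i\in\{1,\ldots,r\}$. Let $(p,q)$ be the signature of $M$. Let $E_0$ be the eigenspace associated with the eigenvalue $0$ of $M$, with the convention $E_0=\emptyset$ if $0$ is not an eigenvalue of $M$. Let $\ell\in\mathbb{R}^n$ be any vector with $\ell^\top j=1$. Then the signature of $F_M(\ell)$ is given as follows. (1) If $E_0\subset j^\perp$ and $\sum_{i=1}^r \beta_i^2/\lambda_i=0$, then the signature of $F_M(\ell)$ is $(q-1,p-1)$. (2) If $E_0\subset j^\perp$ and $\sum_{i=1}^r \beta_i^2/\lambda_i>0$, then the signature of $F_M(\ell)$ is $(q,p-1)$. (3) If $E_0\subset j^\perp$ and $\sum_{i=1}^r \beta_i^2/\lambda_i<0$, then the signature of $F_M(\ell)$ is $(q-1,p)$. (4) If $E_0\not\subset j^\perp$, then the signature of $F_M(\ell)$ is $(q,p)$.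
   Context: $j\in\mathbb{R}^n$ is the all-one vector, $I$ is the identity matrix, and $j^\perp$ is the orthogonal complement of $j$ for the standard inner product. The signature of a real symmetric matrix is the pair (number of positive eigenvalues, number of negative eigenvalues), counted with multiplicity. For a real symmetric matrix $M$ of order $n$ and $\ell\in\mathbb{R}^n$ with $\ell^\top j=1$, define $F_M(\ell)=-(I-j\ell^\top)M(I-\ell j^\top)$. (It is known, by Gower, that the signature of $F_M(\ell)$ does not depend on the choice of $\ell$ with $\ell^\top j=1$.) If $\tau$ is an eigenvalue of $M$ and $E$ is the orthogonal projection matrix onto its eigenspace, the main angle of $\tau$ is $\beta=\frac{1}{\sqrt n}\sqrt{(Ej)^\top(Ej)}$; the eigenvalue $\tau$ is called main if $\beta\neq 0$, i.e. if its eigenspace is not contained in $j^\perp$. *)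

(* Defs.v *)
From mathcomp Require Import all_boot all_order all_algebra.
From mathcomp Require Import sesquilinear.
From mathcomp Require Import polyrcf.
From mathcomp Require Import reals.

Set Implicit Arguments.
Unset Strict Implicit.
Unset Printing Implicit Defensive.

Import Order.TTheory GRing.Theory Num.Theory.
Local Open Scope ring_scope.

Section Defs.

Variables (R : realType) (n : nat).

(* MathComp subspaces are row spaces; eigenspaces consist of left (row)
   eigenvectors.  For the symmetric matrices considered here these are the
   transposes of the usual column eigenvectors. *)

Definition onev : 'cV[R]_n := const_mx 1.

Definition orthocomp m (U : 'M[R]_(m, n)) : 'M[R]_n := orthomx idfun 1%:M U.

(* The matrix projecting onto U parallel to its orthogonal complement; being
   symmetric, it represents the same map on rows and on columns. *)
Definition orthoproj (U : 'M[R]_n) : 'M[R]_n := proj_mx U (orthocomp U).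

(* rootsR lists the distinct real roots, and mup is the multiplicity of a root.
   The components live in int so that subtracting 1 is not truncated. *)
Definition signature (M : 'M[R]_n) : int * int :=
  ((\sum_(a <- rootsR (char_poly M) | (0 < a)%R) mup a (char_poly M))%N%:Z,
   (\sum_(a <- rootsR (char_poly M) | (a < 0)%R) mup a (char_poly M))%N%:Z).

Definition gowerF (M : 'M[R]_n) (l : 'cV[R]_n) : 'M[R]_n :=
  - ((1%:M - onev *m l^T) *m M *m (1%:M - l *m onev^T)).

Definition main_angle (M : 'M[R]_n) (a : R) : R :=
  let Ej := orthoproj (eigenspace M a) *m onev in
  (Num.sqrt n%:R)^-1 * Num.sqrt ((Ej^T *m Ej) 0 0).

Definition main_eigenvalue (M : 'M[R]_n) : pred R :=
  fun a => eigenvalue M a && (main_angle M a != 0).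

End Defs.

Arguments onev {R n}.

(* Main.v *)
Require Import Defs.
From mathcomp Require Import all_boot all_order all_algebra.
From mathcomp Require Import spectral complex polyrcf sesquilinear.
From mathcomp Require Import reals ring lra.

(** Put [S = I - j l^T] and [K = S M S^T], so that [F_M(l) = - K].  The signature
    of [F_M(l)] is therefore obtained from the positive indices of [K] and of
    [- K], and [- K] is built from [- M] as [K] is from [M]; everything reduces to
    comparing the positive index of [K] with that of [M].

    The comparison rests on Sylvester's description of the number of positive
    eigenvalues as the largest dimension of a subspace on which the quadratic
    form is positive definite ([posidx_max], [posidx_attained]), which follows
    from the spectral theorem ([symmetric_diagonalization]).  Since [x S = x] for
    a row [x] orthogonal to [j], while [S] maps every row into [j^\perp], the
    form [K] is the restriction of [M] to [j^\perp] pulled back along the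
    projection [S].  Hence the index of [K] does not depend on [l]
    ([posidx_centered_indep]), and it is that of [M] or one less, since
    intersecting with a hyperplane loses at most one dimension
    ([posidx_le_centered_succ]).

    If [E_0] is not contained in [j^\perp], one may choose [l] in the kernel of
    [M], and then [K = M].  Otherwise [j] lies in the image of [M]: say
    [M w = j].  The sign of [c = j^T w = w^T M w] decides the matter.
    - If [c < 0], the choice [l = w / c] gives [K = M - c^-1 j j^T], whose form
      dominates that of [M], so the index is unchanged
      ([posidx_le_centered]).
    - If [c >= 0], a positive definite subspace of [j^\perp] can be enlarged by
      one vector [x + t w] with [t] large, so the index drops by one
      ([posidx_centered_lt]).
    Replacing [M] by [- M] replaces [w] by [- w] and [c] by [- c], which yields
    the other index.  Finally, expanding [j] in an orthonormal eigenbasis gives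
    [c = n \sum_i beta_i^2 / lambda_i] ([onev_preimage]). *)

Import Order.TTheory GRing.Theory Num.Theory.
Local Open Scope ring_scope.

Set Implicit Arguments.
Unset Strict Implicit.
Unset Printing Implicit Defensive.

(** * Spectral theorem for real symmetric matrices *)

Lemma mulmx_trE (R : rcfType) n (x : 'rV[R]_n) :
  (x *m x^T) 0 0 = \sum_i x 0 i ^+ 2.
Proof. by rewrite mxE; apply: eq_bigr => i _; rewrite mxE expr2. Qed.

Lemma mulmx_tr_ge0 (R : rcfType) n (x : 'rV[R]_n) : 0 <= (x *m x^T) 0 0.
Proof. by rewrite mulmx_trE sumr_ge0 // => i _; apply: sqr_ge0. Qed.

Lemma mulmx_tr_eq0 (R : rcfType) n (x : 'rV[R]_n) :
  ((x *m x^T) 0 0 == 0) = (x == 0).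
Proof.
rewrite mulmx_trE psumr_eq0 => [|i _]; last exact: sqr_ge0.
apply/allP/eqP => [x0|-> i _]; last by rewrite mxE expr0n eqxx.
apply/rowP => i; apply/eqP; rewrite mxE -sqrf_eq0.
by apply: x0; apply: mem_index_enum.
Qed.

(** Over the complex numbers the matrix is Hermitian, so the first entry of its
    spectral diagonal is real; eigenvalues being the roots of the
    characteristic polynomial, which has real coefficients, this entry is an
    eigenvalue over the base field as well. *)
Lemma symmetric_eigenvalue (R : rcfType) n (A : 'M[R]_n.+1) :
  A^T = A -> exists a, eigenvalue A a.
Proof.
move=> A_sym; pose f := real_complex R; pose C := map_mx f A.
have C_herm : C \is hermsymmx.
  rewrite qualifE /= expr0 scale1r; apply/eqP/matrixP => i j.
  rewrite !mxE; have -> : A j i = A i j by rewrite -[in LHS]A_sym mxE.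
  by apply/esym/CrealP/complex_realP; exists (A i j).
have C_spec := orthomx_spectralP (hermitian_normalmx C_herm).
have /mxOverP/(_ 0 0)/complex_realP[a a_def] := hermitian_spectral_diag_real C_herm.
exists a; rewrite eigenvalue_root_char -(fmorph_root f) map_char_poly.
rewrite -eigenvalue_root_char -/C.
pose P := spectralmx C; have P_unit : P \in unitmx := spectral_unit C.
have P_C : P *m C = diag_mx (spectral_diag C) *m P.
  by rewrite [in LHS]C_spec -/P !mulmxA mulmxV // mul1mx.
apply/eigenvalueP; exists (row 0 P).
  by rewrite -row_mul P_C mul_diag_mx; apply/rowP => j; rewrite !mxE a_def.
apply/eqP => P0; have : row 0 P *m invmx P = 0 by rewrite P0 mul0mx.
rewrite -row_mul mulmxV // => /rowP/(_ 0); rewrite !mxE eqxx => /eqP.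
by rewrite oner_eq0.
Qed.

(** The Householder reflection exchanging [v] and the first basis vector [e], along
    [u = v - e]; the identity if they coincide. *)
Lemma orthogonal_with_row0 (R : rcfType) n (v : 'rV[R]_n.+1) :
  v *m v^T = 1%:M ->
  exists2 H : 'M[R]_n.+1, H *m H^T = 1%:M & row 0 H = v.
Proof.
move=> v1; pose e : 'rV[R]_n.+1 := delta_mx 0 0.
have [u u_def] : exists u, u = v - e by exists (v - e).
have [u0|u_neq0] := eqVneq u 0.
  exists 1%:M; first by rewrite trmx1 mulmx1.
  by rewrite row1; apply/esym/eqP; rewrite -subr_eq0 -/e -u_def u0.
have ee : e *m e^T = 1%:M.
  by rewrite trmx_delta mul_delta_mx; apply/matrixP=> i j; rewrite !ord1 !mxE !eqxx.
pose c := (v *m e^T) 0 0.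
have ve : v *m e^T = c%:M by rewrite -mx11_scalar.
have ev : e *m v^T = c%:M by rewrite -[LHS]trmxK trmx_mul trmxK ve tr_scalar_mx.
have uu : u *m u^T = (2 * (1 - c))%:M.
  rewrite u_def linearB /= mulmxBl !mulmxBr v1 ee ve ev -!rmorphB /=.
  by congr (_%:M); ring.
have eu : e *m u^T = (c - 1)%:M by rewrite u_def linearB /= mulmxBr ev ee -rmorphB.
(* The reflection along u divides by half the square norm of u. *)
have c1 : 1 - c != 0.
  apply: contra u_neq0 => /eqP c0.
  by rewrite -mulmx_tr_eq0 uu c0 mulr0 mxE mul0rn.
pose H := 1%:M - (1 - c)^-1 *: (u^T *m u).
have H_sym : H^T = H.
  by rewrite /H linearB linearZ /= trmx1 trmx_mul trmxK.
exists H.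
  rewrite H_sym /H mulmxBl !mulmxBr !mulmx1 mul1mx -scalemxAl -scalemxAr.
  rewrite -mulmxA (mulmxA u) uu mul_scalar_mx -scalemxAr scalerA.
  rewrite (_ : (1 - c)^-1 * _ = 2); last by field.
  by rewrite scaler_nat mulr2n scalerDr opprB addrK subrK.
rewrite rowE -/e mulmxBr mulmx1 -scalemxAr mulmxA eu mul_scalar_mx scalerA.
by rewrite -[c - 1]opprB mulrN mulVf // scaleN1r opprK u_def addrC subrK.
Qed.

(** The real spectral theorem, by induction: an orthogonal change of basis that
    sends the first basis vector to a unit eigenvector leaves, by symmetry, a
    block-diagonal matrix. *)
Lemma symmetric_diagonalization (R : rcfType) n (A : 'M[R]_n) : A^T = A ->
  exists (P : 'M[R]_n) (d : 'rV[R]_n),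
    P *m P^T = 1%:M /\ A = P^T *m diag_mx d *m P.
Proof.
elim: n A => [|n IHn] A A_sym; first by exists 1%:M, 0; split; apply/matrixP => - [].
have [a /eigenvalueP[x xA x_neq0]] := symmetric_eigenvalue A_sym.
pose t := (x *m x^T) 0 0.
have t_gt0 : 0 < t.
  by rewrite lt_def mulmx_tr_eq0 x_neq0 mulmx_tr_ge0.
pose v := (Num.sqrt t)^-1 *: x.
have vA : v *m A = a *: v by rewrite -scalemxAl xA !scalerA mulrC.
have vv : v *m v^T = 1%:M.
  rewrite linearZ /= -scalemxAl -scalemxAr scalerA [x *m _]mx11_scalar -/t.
  rewrite scale_scalar_mx -invfM -expr2 sqr_sqrtr ?ltW // mulVf //.
  by rewrite gt_eqF.
have [H HH H0] := orthogonal_with_row0 vv.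
have HtH : H^T *m H = 1%:M by apply: mulmx1C.
pose B : 'M_(1 + n) := H *m A *m H^T.
have B_sym : B^T = B by rewrite !trmx_mul trmxK A_sym mulmxA.
have B0 : row 0 B = a *: delta_mx 0 0.
  by rewrite row_mul row_mul H0 vA -scalemxAl -H0 -row_mul HH row1.
have Bu : usubmx B = row_mx a%:M 0.
  apply/matrixP => i j; rewrite !mxE.
  have -> : lshift n i = 0 by apply/val_inj; rewrite /= ord1.
  have := congr1 (fun r : 'rV_(1 + n) => r 0 j) B0; rewrite !mxE => ->.
  case: splitP => k jk; rewrite !mxE.
    have -> : j = 0 by apply: val_inj; rewrite /= jk ord1.
    by rewrite (ord1 i) (ord1 k) !eqxx mulr1.
  by rewrite andTb (_ : (_ == _) = false) ?mulr0 // -val_eqE /= jk.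
have B_dl : dlsubmx B = 0.
  by rewrite -B_sym -trmx_ursub /ursubmx Bu row_mxKr trmx0.
have Bblock : B = block_mx a%:M 0 0 (drsubmx B).
  rewrite -[LHS]submxK B_dl /ulsubmx /ursubmx Bu row_mxKl row_mxKr.
  exact: erefl.
have [|P' [d' [PP' Bd]]] := IHn (drsubmx B).
  by rewrite trmx_drsub B_sym.
pose Q : 'M[R]_(1 + n) := block_mx 1%:M 0 0 P'.
pose d : 'rV[R]_(1 + n) := row_mx a%:M d'.
have QQ : Q *m Q^T = 1%:M.
  rewrite tr_block_mx mulmx_block !trmx0 trmx1 !mulmx0 !mul0mx mulmx1.
  by rewrite !addr0 !add0r PP' -scalar_mx_block.
have B_def : B = Q^T *m diag_mx d *m Q.
  rewrite Bblock Bd diag_mx_row tr_block_mx !mulmx_block !trmx0 trmx1.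
  rewrite !mulmx0 !mul0mx !mulmx1 !mul1mx !addr0 !add0r.
  congr (block_mx _ _ _ _); rewrite ?mul0mx ?mulmx0 //.
  by apply/matrixP => i j; rewrite (ord1 i) (ord1 j) !mxE.
exists (Q *m H), d; split.
  by rewrite trmx_mul mulmxA -(mulmxA _ H) HH mulmx1.
have -> : A = H^T *m B *m H.
  by rewrite /B !mulmxA HtH mul1mx -mulmxA HtH mulmx1.
by rewrite B_def trmx_mul !mulmxA.
Qed.

Lemma char_poly_diagonalization (R : rcfType) n (A P : 'M[R]_n) d :
  P *m P^T = 1%:M -> A = P^T *m diag_mx d *m P ->
  char_poly A = \prod_i ('X - (d 0 i)%:P).
Proof.
move=> PP ->; have PtP : P^T *m P = 1%:M by apply: mulmx1C.
pose p := map_mx (@polyC R) P.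
have ptp : p^T *m p = 1%:M by rewrite map_trmx -map_mxM PtP map_mx1.
transitivity (char_poly (diag_mx d)); last first.
  rewrite char_poly_trig ?diag_mx_is_trig //.
  by apply: eq_bigr => i _; rewrite mxE eqxx mulr1n.
rewrite /char_poly.
have -> : char_poly_mx (P^T *m diag_mx d *m P) = p^T *m char_poly_mx (diag_mx d) *m p.
  rewrite /char_poly_mx mulmxBr mulmxBl mul_mx_scalar -scalemxAl ptp scalemx1.
  by rewrite !map_mxM -map_trmx.
by rewrite !det_mulmx mulrAC -det_mulmx ptp det1 mul1r.
Qed.

(** * Positive index and positive definite subspaces *)

(** Links a count of eigenvalues with their algebraic multiplicities to a count
    of diagonal entries, for which subspaces are at hand. *)
Lemma sum_mup_diagonalization (R : realType) n (A P : 'M[R]_n) (d : 'rV[R]_n)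
    (p : pred R) :
  P *m P^T = 1%:M -> A = P^T *m diag_mx d *m P ->
  (\sum_(a <- rootsR (char_poly A) | p a) mup a (char_poly A))%N
    = #|[set i | p (d 0 i)]|.
Proof.
move=> PP A_def.
have ch_def := char_poly_diagonalization PP A_def.
have ch_neq0 : char_poly A != 0 by rewrite monic_neq0 ?char_poly_monic.
pose s := [seq d 0 i | i : 'I_n].
have ch_s : char_poly A = \prod_(y <- s) ('X - y%:P).
  by rewrite ch_def big_map big_enum.
transitivity (\sum_(a <- rootsR (char_poly A) | p a) count_mem a s)%N.
  by apply: eq_bigr => a _; rewrite ch_s mu_prod_XsubC.
transitivity (\sum_(a <- rootsR (char_poly A) | p a) \sum_i (d 0%R i == a))%N.
  apply: eq_bigr => a _; rewrite /s count_map -sum1_count big_enum_cond /=.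
  by rewrite big_mkcond /=; apply: eq_bigr => i _; case: eqP.
rewrite exchange_big /= -sum1dep_card [RHS]big_mkcond /=.
apply: eq_bigr => i _.
have di_root : d 0 i \in rootsR (char_poly A).
  have := roots_on_rootsR ch_neq0; move=> /(_ (d 0 i)).
  rewrite in_itv /= => <-; rewrite ch_def; apply/rootP.
  by rewrite horner_prod (bigD1 i) //= hornerXsubC subrr mul0r.
have roots_uniq : uniq (rootsR (char_poly A)) by apply: uniq_roots.
rewrite -big_filter; have [pdi|npdi] := boolP (p (d 0 i)).
  rewrite (bigD1_seq (d 0 i)) ?filter_uniq ?mem_filter ?pdi //= eqxx.
  by rewrite big1_seq ?addn0 // => a /andP[/negPf]; rewrite eq_sym => ->.
rewrite big1_seq // => a /andP[_]; rewrite mem_filter => /andP[pa _].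
by case: eqP => // da; rewrite da pa in npdi.
Qed.

Definition qform (R : realType) n (A : 'M[R]_n) (x : 'rV_n) : R :=
  (x *m A *m x^T) 0 0.

(** The rows of [T] are a family on whose combinations the form of [A] is positive
    definite.  Such a family is automatically free, so its length [m] is the
    dimension of a positive definite subspace. *)
Definition posdef_on (R : realType) n (A : 'M[R]_n) m (T : 'M[R]_(m, n)) : Prop :=
  forall x : 'rV_m, x != 0 -> 0 < qform A (x *m T).

(** The first component of [signature A], kept in [nat].  The second one is
    [posidx (- A)], so that every fact on indices is needed for one sign only. *)
Definition posidx (R : realType) n (A : 'M[R]_n) : nat :=
  (\sum_(a <- rootsR (char_poly A) | (0 < a)%R) mup a (char_poly A))%N.

Lemma signatureE (R : realType) n (A : 'M[R]_n) : A^T = A ->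
  signature A = ((posidx A)%:Z, (posidx (- A))%:Z).
Proof.
move=> A_sym; have [P [d [PP A_def]]] := symmetric_diagonalization A_sym.
have NA_def : - A = P^T *m diag_mx (- d) *m P.
  by rewrite A_def linearN mulmxN mulNmx.
congr (_, (Posz _)); rewrite /posidx (sum_mup_diagonalization _ PP A_def).
rewrite (sum_mup_diagonalization _ PP NA_def).
by apply: eq_card => i; rewrite !inE mxE oppr_gt0.
Qed.

Lemma qform_diagonalization (R : realType) n (P : 'M[R]_n) (d y : 'rV[R]_n) :
  P *m P^T = 1%:M ->
  qform (P^T *m diag_mx d *m P) (y *m P) = \sum_i d 0 i * y 0 i ^+ 2.
Proof.
move=> PP; rewrite /qform trmx_mul !mulmxA -(mulmxA y) PP mulmx1.
rewrite -(mulmxA _ P) PP mulmx1 mxE; apply: eq_bigr => i _.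
by rewrite mul_mx_diag !mxE mulrAC mulrC expr2.
Qed.

(** A positive definite subspace of dimension larger than the number of positive
    eigenvalues would contain a nonzero vector orthogonal to all the
    corresponding eigenvectors, and the form is nonpositive there. *)
Lemma posidx_max (R : realType) n (A : 'M[R]_n) m (T : 'M[R]_(m, n)) :
  A^T = A -> posdef_on A T -> (m <= posidx A)%N.
Proof.
move=> A_sym T_pos; have [P [d [PP A_def]]] := symmetric_diagonalization A_sym.
rewrite /posidx (sum_mup_diagonalization _ PP A_def); set I := [set i | _].
rewrite leqNgt; apply/negP => lt_I_m.
pose B : 'M_(m, #|I|) := colsub enum_val (T *m P^T).
have /rowV0Pn[x /sub_kermxP xB x_neq0] : kermx B != 0.
  by rewrite -mxrank_eq0 mxrank_ker subn_eq0 -ltnNge (leq_ltn_trans (rank_leq_col _)).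
have := T_pos x x_neq0; pose y := x *m (T *m P^T).
have -> : x *m T = y *m P by rewrite /y -!mulmxA (mulmx1C PP) mulmx1.
rewrite A_def qform_diagonalization // ltNge => /negP; apply.
apply: sumr_le0 => i _; have [iI|] := boolP (i \in I).
  have -> : y 0 i = 0; last by rewrite expr0n mulr0.
  have := congr1 (fun r : 'rV_#|I| => r 0 (enum_rank_in iI i)) xB.
  by rewrite /B mulmx_colsub !mxE enum_rankK_in.
rewrite inE -leNgt => di; rewrite mulr_le0_ge0 ?sqr_ge0 //.
Qed.

(** The span of the eigenvectors with positive eigenvalue. *)
Lemma posidx_attained (R : realType) n (A : 'M[R]_n) :
  A^T = A -> exists T : 'M[R]_(posidx A, n), posdef_on A T.
Proof.
move=> A_sym; have [P [d [PP A_def]]] := symmetric_diagonalization A_sym.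
rewrite /posidx (sum_mup_diagonalization _ PP A_def); set I := [set i | _].
pose J : 'M[R]_(#|I|, n) := rowsub enum_val 1%:M.
exists (J *m P) => x x_neq0; rewrite mulmxA A_def qform_diagonalization //.
have xJ r : (x *m J) 0 (enum_val r) = x 0 r.
  rewrite mxE (bigD1 r) //= !mxE eqxx mulr1 big1 ?addr0 // => s s_r.
  by rewrite !mxE (inj_eq enum_val_inj) (negPf s_r) mulr0.
have xJ0 i : i \notin I -> (x *m J) 0 i = 0.
  move=> iI; rewrite mxE big1 // => s _; rewrite !mxE.
  by case: eqP => [si|]; rewrite ?mulr0 //; rewrite -si enum_valP in iI.
have term_ge0 i : 0 <= d 0 i * (x *m J) 0 i ^+ 2.
  have [|iI] := boolP (i \in I); last by rewrite xJ0 // expr0n mulr0.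
  by rewrite inE => di; rewrite mulr_ge0 ?sqr_ge0 // ltW.
rewrite lt_def sumr_ge0 ?andbT // psumr_eq0 //.
apply: contra x_neq0 => /allP all0; apply/eqP/rowP => r; rewrite mxE.
have := all0 (enum_val r) (mem_index_enum _); rewrite xJ mulf_eq0 sqrf_eq0.
have := enum_valP r; rewrite inE => /gt_eqF -> /eqP.
exact.
Qed.

Lemma posidx_le (R : realType) n (A B : 'M[R]_n) : A^T = A -> B^T = B ->
  (forall x, qform A x <= qform B x) -> (posidx A <= posidx B)%N.
Proof.
move=> A_sym B_sym AB; have [T T_pos] := posidx_attained A_sym.
by apply: (@posidx_max _ _ _ _ T) => // x /T_pos /lt_le_trans; apply.
Qed.

Lemma qform_congr (R : realType) m n (S : 'M[R]_(m, n)) (A : 'M[R]_n) x :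
  qform (S *m A *m S^T) x = qform A (x *m S).
Proof. by rewrite /qform trmx_mul !mulmxA. Qed.

(** One half of Sylvester's law of inertia; [S] need not be invertible, because it
    maps a positive definite subspace of the congruent form injectively to one
    of the form of [A]. *)
Lemma posidx_congr (R : realType) m n (S : 'M[R]_(m, n)) (A : 'M[R]_n) :
  A^T = A -> (posidx (S *m A *m S^T) <= posidx A)%N.
Proof.
move=> A_sym; have [|T T_pos] := @posidx_attained _ _ (S *m A *m S^T).
  by rewrite !trmx_mul trmxK A_sym mulmxA.
apply: (@posidx_max _ _ _ _ (T *m S)) => // x /T_pos.
by rewrite qform_congr mulmxA.
Qed.

Lemma qformD (R : realType) n (A : 'M[R]_n) x y : A^T = A ->
  qform A (x + y) = qform A x + qform A y + 2 * (x *m A *m y^T) 0 0.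
Proof.
move=> A_sym; have yx : (y *m A *m x^T) 0 0 = (x *m A *m y^T) 0 0.
  have -> : x *m A *m y^T = (y *m A *m x^T)^T.
    by rewrite !trmx_mul trmxK A_sym mulmxA.
  by rewrite [RHS]mxE.
rewrite /qform linearD /= !mulmxDl !mulmxDr.
move: (x *m A *m x^T) (x *m A *m y^T) (y *m A *m x^T) (y *m A *m y^T) yx.
by move=> a b c d; rewrite !mxE => ->; ring.
Qed.

Lemma qformZ (R : realType) n (A : 'M[R]_n) a x :
  qform A (a *: x) = a ^+ 2 * qform A x.
Proof.
by rewrite /qform linearZ /= -!scalemxAl -scalemxAr scalerA mxE expr2.
Qed.

(** A vector orthogonal to the family for the form of [A] contributes no cross
    term. *)
Lemma posdef_on_extend (R : realType) n (A : 'M[R]_n) m (T : 'M[R]_(m, n))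
    (v : 'rV[R]_n) : A^T = A ->
  posdef_on A T -> T *m A *m v^T = 0 -> 0 < qform A v ->
  posdef_on A (col_mx T v).
Proof.
move=> A_sym T_pos Tv v_pos x; rewrite -[x]hsubmxK mul_row_col.
set y := lsubmx x; set s := rsubmx x => ys.
have -> : s *m v = s 0 0 *: v by rewrite [in LHS](mx11_scalar s) mul_scalar_mx.
rewrite qformD // qformZ linearZ /= -scalemxAr -!mulmxA (mulmxA T) Tv.
rewrite mulmx0 scaler0 [(0 : 'M__) _ _]mxE mulr0 addr0.
have [y0|y_neq0] := eqVneq y 0.
  have s_neq0 : s 0 0 != 0.
    apply: contra ys => /eqP s0; rewrite [s]mx11_scalar s0 y0 raddf0.
    by rewrite row_mx0.
  rewrite y0 mul0mx /qform !mul0mx mxE add0r mulr_gt0 //.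
  by rewrite lt_def sqrf_eq0 s_neq0 sqr_ge0.
by rewrite ltr_pwDl ?T_pos // mulr_ge0 ?sqr_ge0 // ltW.
Qed.

(** * Centering a symmetric matrix *)

(** On rows, the projection onto the orthogonal complement of [onev] parallel to
    [l^T], when the entries of [l] sum to one. *)
Definition centering (R : realType) n (l : 'cV[R]_n) : 'M[R]_n :=
  1%:M - onev *m l^T.

Definition centered (R : realType) n (M : 'M[R]_n) (l : 'cV[R]_n) : 'M[R]_n :=
  centering l *m M *m (centering l)^T.

Lemma tr_centering (R : realType) n (l : 'cV[R]_n) :
  (centering l)^T = 1%:M - l *m onev^T.
Proof. by rewrite linearB /= trmx1 trmx_mul trmxK. Qed.

Lemma gowerFE (R : realType) n (M : 'M[R]_n) l : gowerF M l = - centered M l.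
Proof. by rewrite /centered tr_centering. Qed.

Lemma centeredN (R : realType) n (M : 'M[R]_n) l :
  centered (- M) l = - centered M l.
Proof. by rewrite /centered mulmxN mulNmx. Qed.

Lemma centered_sym (R : realType) n (M : 'M[R]_n) l :
  M^T = M -> (centered M l)^T = centered M l.
Proof. by move=> M_sym; rewrite !trmx_mul trmxK M_sym mulmxA. Qed.

Lemma centering_onev (R : realType) n (l : 'cV[R]_n) :
  l^T *m onev = 1%:M -> centering l *m onev = 0.
Proof. by move=> l1; rewrite mulmxBl mul1mx -mulmxA l1 mulmx1 subrr. Qed.

Lemma centering_id (R : realType) m n (U : 'M[R]_(m, n)) (l : 'cV[R]_n) :
  U *m onev = 0 -> U *m centering l = U.
Proof. by move=> U1; rewrite mulmxBr mulmx1 mulmxA U1 mul0mx subr0. Qed.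

Lemma centeredE (R : realType) n (M : 'M[R]_n) (l : 'cV[R]_n) a :
  M^T = M -> l^T *m onev = 1%:M -> M *m l = a *: onev ->
  centered M l = M - a *: (onev *m onev^T).
Proof.
move=> M_sym l1 Ml; have lM : l^T *m M = a *: onev^T.
  by rewrite -[in LHS]M_sym -trmx_mul Ml linearZ.
have l1' : onev^T *m l = 1%:M by rewrite -[LHS]trmxK trmx_mul trmxK l1 trmx1.
rewrite /centered tr_centering mulmxBl mul1mx -mulmxA lM -scalemxAr.
rewrite mulmxBr mulmx1 mulmxA mulmxBl Ml -scalemxAl -(mulmxA onev) l1' mulmx1.
by rewrite subrr mul0mx subr0.
Qed.

Lemma posidx_centered_le (R : realType) n (M : 'M[R]_n) l :
  M^T = M -> (posidx (centered M l) <= posidx M)%N.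
Proof. exact: posidx_congr. Qed.

(** The two projections have the same range, so composing them gives the first:
    each centered matrix is obtained by centering the other one. *)
Lemma posidx_centered_indep (R : realType) n (M : 'M[R]_n) (l l' : 'cV[R]_n) :
  M^T = M -> l^T *m onev = 1%:M -> l'^T *m onev = 1%:M ->
  posidx (centered M l) = posidx (centered M l').
Proof.
move=> M_sym.
have le_posidx (u v : 'cV[R]_n) : u^T *m onev = 1%:M ->
    (posidx (centered M u) <= posidx (centered M v))%N.
  move=> u1; have -> : centered M u = centered (centered M v) u.
    have uv := centering_id v (centering_onev u1).
    by rewrite /centered -[in LHS]uv trmx_mul !mulmxA.
  exact/posidx_centered_le/centered_sym.
by move=> l1 l1'; apply/eqP; rewrite eqn_leq !le_posidx.
Qed.

(** A positive definite subspace of [M] meets the hyperplane orthogonal to [onev] in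
    codimension at most one, and both forms agree on that hyperplane. *)
Lemma posidx_le_centered_succ (R : realType) n (M : 'M[R]_n) l :
  M^T = M -> l^T *m onev = 1%:M -> (posidx M <= (posidx (centered M l)).+1)%N.
Proof.
move=> M_sym l1; have [T T_pos] := posidx_attained M_sym.
pose Z := row_base (kermx (T *m onev)).
have Z0 : Z *m T *m onev = 0.
  by rewrite -mulmxA; apply/sub_kermxP; rewrite eq_row_base.
have Z_pos : posdef_on (centered M l) (Z *m T).
  move=> x x_neq0; rewrite qform_congr -mulmxA (centering_id l Z0) mulmxA.
  by apply: T_pos; rewrite mulmx_free_eq0 ?row_base_free.
have := posidx_max (centered_sym l M_sym) Z_pos; rewrite mxrank_ker.
have := rank_leq_col (T *m onev); case: (\rank _) => [|[|//]] _.
  by rewrite subn0 => /leq_trans; apply.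
by rewrite leq_subLR add1n.
Qed.

(** Projecting a maximal positive definite subspace of the centered form gives a
    positive definite subspace of [M] orthogonal to [onev], with basis [T].  The
    row [w^T] is [M]-orthogonal to it, since [M w] is [onev].  Subtracting from
    [l^T] its [M]-projection on [T] yields [x] with the same property and
    [x *m onev = 1]; along [x + t w^T] the form is [qform M x + 2 t + t^2 c], which
    is positive for large [t] because [c >= 0]. *)
Lemma posidx_centered_lt (R : realType) n (M : 'M[R]_n) (w l : 'cV[R]_n) :
  M^T = M -> l^T *m onev = 1%:M ->
  M *m w = onev -> 0 <= (w^T *m onev) 0 0 ->
  (posidx (centered M l) < posidx M)%N.
Proof.
move=> M_sym l1 Mw c_ge0; set c := (_ 0 0) in c_ge0.
have [T0 T0_pos] := posidx_attained (centered_sym l M_sym).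
have [T T1 T_pos] :
    exists2 T : 'M_(_, n), T *m onev = 0 & @posdef_on _ _ M (posidx (centered M l)) T.
  exists (T0 *m centering l); first by rewrite -mulmxA centering_onev // mulmx0.
  by move=> x /T0_pos; rewrite qform_congr mulmxA.
pose G := T *m M *m T^T.
have G_unit : G \in unitmx.
  rewrite -row_free_unit -kermx_eq0; apply/negPn/negP => /rowV0Pn[x].
  move=> /sub_kermxP xG /T_pos; rewrite /qform trmx_mul !mulmxA.
  by rewrite -(mulmxA x) -(mulmxA x) -/G xG mul0mx mxE ltxx.
have wM : w^T *m M = onev^T by rewrite -[in LHS]M_sym -trmx_mul Mw.
have [x x1 xT] : exists2 x : 'rV_n, x *m onev = 1%:M & x *m M *m T^T = 0.
  exists (l^T - l^T *m M *m T^T *m invmx G *m T).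
    by rewrite mulmxBl l1 -!mulmxA T1 !mulmx0 subr0.
  rewrite !mulmxBl -(mulmxA _ T M) -(mulmxA _ (T *m M)) -/G.
  by rewrite mulmxKV ?subrr.
(* The form at x + t w is a + 2 t + t ^ 2 c, so t only has to exceed - a / 2. *)
pose a := qform M x; pose t := `|a| + 1.
pose v := x + t *: w^T.
have vT : T *m M *m v^T = 0.
  have -> : T *m M *m v^T = (v *m M *m T^T)^T.
    by rewrite !trmx_mul trmxK M_sym mulmxA.
  by rewrite !mulmxDl xT add0r -!scalemxAl wM -trmx_mul T1 trmx0 scaler0 trmx0.
have v_pos : 0 < qform M v.
  rewrite qformD // qformZ -/a linearZ /= trmxK -scalemxAr -mulmxA Mw x1.
  rewrite /qform trmxK -mulmxA Mw -/c !mxE eqxx mulr1n mulr1.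
  have t_gt0 : 0 < t by rewrite ltr_wpDl.
  have a_le : - a <= `|a| by rewrite -normrN ler_norm.
  have : 0 <= t ^+ 2 * c by rewrite mulr_ge0 ?sqr_ge0.
  by rewrite /t in t_gt0 *; lra.
have := posidx_max M_sym (posdef_on_extend M_sym T_pos vT v_pos).
by rewrite addn1.
Qed.

(** By independence of [l] one may take [l = w / c], for which centering
    subtracts the negative semidefinite matrix [c^-1 j j^T]. *)
Lemma posidx_le_centered (R : realType) n (M : 'M[R]_n) (w l : 'cV[R]_n) :
  M^T = M -> l^T *m onev = 1%:M ->
  M *m w = onev -> (w^T *m onev) 0 0 < 0 ->
  (posidx M <= posidx (centered M l))%N.
Proof.
move=> M_sym l1 Mw; set c := (_ 0 0) => c_lt0.
have w1 : w^T *m onev = c%:M by rewrite [LHS]mx11_scalar.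
have c_neq0 : c != 0 by rewrite lt_eqF.
pose u := c^-1 *: w.
have u1 : u^T *m onev = 1%:M.
  by rewrite linearZ /= -scalemxAl w1 scale_scalar_mx mulVf.
rewrite (posidx_centered_indep M_sym l1 u1).
have Mu : M *m u = c^-1 *: onev by rewrite -scalemxAr Mw.
apply: posidx_le => // [|x]; first exact: centered_sym.
rewrite (centeredE M_sym u1 Mu).
have xjx : x *m (onev *m onev^T) *m x^T = (x *m onev) *m (x *m onev)^T.
  by rewrite trmx_mul !mulmxA.
rewrite /qform mulmxBr mulmxBl -scalemxAr -scalemxAl xjx.
have := mulmx_tr_ge0 (x *m onev); set r := _ *m _^T => r_ge0.
rewrite [leRHS]mxE lerDl mxE oppr_ge0 mxE mulr_le0_ge0 //.
by rewrite invr_le0 ltW.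
Qed.

(** * Main angles in an orthonormal eigenbasis *)

Lemma sub_orthocomp (R : realType) n k m (W : 'M[R]_(k, n)) (U : 'M[R]_(m, n)) :
  (W <= orthocomp U)%MS = (W *m U^T == 0).
Proof.
rewrite /orthocomp /orthomx mul1mx map_mx_id //.
by apply/idP/idP => [/sub_kermxP->|/eqP/sub_kermxP].
Qed.

(** A vector in the intersection is orthogonal to itself. *)
Lemma cap_orthocomp (R : realType) n m (U : 'M[R]_(m, n)) :
  (U :&: orthocomp U)%MS = 0.
Proof.
apply/eqP/rowV0Pn => - [x]; rewrite sub_capmx sub_orthocomp.
case/andP => /submxP[y xy] /eqP xU /negP; apply.
rewrite -mulmx_tr_eq0 {2}xy trmx_mul mulmxA xU mul0mx mxE.
exact: eqxx.
Qed.

(** In an orthonormal eigenbasis the orthogonal projection on an eigenspace keeps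
    the coordinates with that eigenvalue.  The symmetric matrix [E] on the right
    has its range in the eigenspace [U] and fixes [U], hence [I - E] has its range
    in the orthogonal complement; this determines the projection. *)
Lemma orthoprojE (R : realType) n (P : 'M[R]_n) d a :
  P *m P^T = 1%:M ->
  orthoproj (eigenspace (P^T *m diag_mx d *m P) a) =
    P^T *m diag_mx (\row_i (d 0 i == a)%:R) *m P.
Proof.
move=> PP; have PtP := mulmx1C PP; set M := _ *m P; set U := eigenspace M a.
set e := \row_i _; set E := P^T *m diag_mx e *m P.
have E_sym : E^T = E by rewrite /E !trmx_mul trmxK tr_diag_mx mulmxA.
have EU : (E <= U)%MS.
  apply/eigenspaceP; rewrite /E /M !mulmxA -(mulmxA _ P) PP mulmx1.
  rewrite scalemxAl scalemxAr; congr (_ *m _); rewrite -mulmxA; congr (_ *m _).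
  apply/matrixP => i j; rewrite mul_diag_mx !mxE.
  by case: eqP => [->|_]; rewrite ?mul1r ?mul0r ?mulr0 ?mul0rn ?mulr0 ?mulr_natr.
have UE : U *m E = U.
  have /eigenspaceP UM := submx_refl U.
  have UPd : U *m P^T *m diag_mx d = a *: (U *m P^T).
    rewrite scalemxAl -UM /M !mulmxA -(mulmxA _ P) PP mulmx1 //.
  have UPe : U *m P^T *m diag_mx e = U *m P^T.
    apply/matrixP => i j; have := congr1 (fun A : 'M_n => A i j) UPd.
    move: (U *m P^T) => W; rewrite !mul_mx_diag !mxE => Wd.
    have [da|da] := eqVneq; first by rewrite mulr1.
    rewrite mulr0; apply/esym/eqP; move/eqP: Wd.
    rewrite mulrC -subr_eq0 -mulrBl mulf_eq0 subr_eq0 (negPf da) //.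
  by rewrite /E !mulmxA UPe -mulmxA PtP mulmx1.
have cE : (1%:M - E <= orthocomp U)%MS.
  by rewrite sub_orthocomp -E_sym mulmxBl mul1mx -trmx_mul UE subrr.
rewrite /orthoproj -[LHS]mul1mx -(subrK E 1%:M) mulmxDl.
by rewrite proj_mx_0 ?cap_orthocomp // proj_mx_id ?cap_orthocomp // add0r.
Qed.

Lemma main_angle_sqr (R : realType) n (P : 'M[R]_n) d a :
  P *m P^T = 1%:M ->
  main_angle (P^T *m diag_mx d *m P) a ^+ 2 =
    n%:R^-1 * \sum_(i | d 0 i == a) (P *m onev) i 0 ^+ 2.
Proof.
move=> PP; rewrite /main_angle orthoprojE //; set e := \row_i _.
rewrite exprMn exprVn sqr_sqrtr ?ler0n //; congr (_ * _).
set Ej := _ *m onev.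
have -> : (Ej^T *m Ej) 0 0 = \sum_(i | d 0 i == a) (P *m onev) i 0 ^+ 2.
  have -> : Ej^T *m Ej = (P *m onev)^T *m diag_mx e *m (P *m onev).
    rewrite /Ej !trmx_mul trmxK tr_diag_mx !mulmxA -(mulmxA _ P P^T) PP mulmx1.
    rewrite -(mulmxA _ (diag_mx e) (diag_mx e)); congr (_ *m _ *m _ *m _).
    apply/matrixP => i j; rewrite mul_diag_mx !mxE.
    by case: (d 0 i == a); rewrite ?mul1r ?mul0r ?mul0rn.
  rewrite mxE [RHS]big_mkcond /=; apply: eq_bigr => i _.
  rewrite mul_mx_diag; move: (P *m onev) => y; rewrite !mxE.
  by case: eqP; rewrite ?mulr1 ?mulr0 ?mul0r // expr2.
by rewrite sqr_sqrtr // sumr_ge0 // => i _; apply: sqr_ge0.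
Qed.

Lemma eigenspace0_coord (R : realType) n (P : 'M[R]_n) d i :
  P *m P^T = 1%:M ->
  (eigenspace (P^T *m diag_mx d *m P) 0 <= orthocomp onev^T)%MS ->
  d 0 i = 0 -> (P *m onev) i 0 = 0.
Proof.
move=> PP E0j di; have Pi : (row i P <= eigenspace (P^T *m diag_mx d *m P) 0)%MS.
  apply/eigenspaceP; rewrite -row_mul !mulmxA PP mul1mx scale0r.
  by apply/rowP => k; rewrite mul_diag_mx !mxE di mul0r.
have := submx_trans Pi E0j; rewrite sub_orthocomp trmxK -row_mul.
by move=> /eqP/rowP/(_ 0); rewrite !mxE.
Qed.

(** With [y] the coordinates of [onev] in an orthonormal eigenbasis, [y i] vanishes
    whenever the eigenvalue [d i] is zero, so [w] is obtained by dividing each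
    coordinate by its eigenvalue and [w^T j] is the sum of the [y i ^+ 2 / d i].
    Grouping this sum by eigenvalue gives the main angles; eigenvalues that are
    not main only carry zero coordinates. *)
Lemma onev_preimage (R : realType) n (M : 'M[R]_n) (M_sym : M^T = M)
    r (lambda : 'I_r -> R) (lambda_inj : injective lambda)
    (lambdaP : forall a : R,
        main_eigenvalue M a <-> exists i : 'I_r, lambda i = a) :
  (eigenspace M 0 <= orthocomp onev^T)%MS ->
  exists2 w : 'cV[R]_n, M *m w = onev
    & (w^T *m onev) 0 0 = n%:R * \sum_(i < r) main_angle M (lambda i) ^+ 2 / lambda i.
Proof.
have [n0|n_gt0] := posnP n.
  move: M M_sym lambdaP; rewrite n0 => M _ _ _; exists 0; first by apply/matrixP=> -[].
  by rewrite mul0r mxE big_ord0.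
have [P [d [PP M_def]]] := symmetric_diagonalization M_sym; have PtP := mulmx1C PP.
rewrite M_def => E0j; pose y := P *m onev.
(* At d i = 0 the quotient is 0, as is y i. *)
pose z : 'cV[R]_n := \col_i (y i 0 / d 0 i).
have dz : diag_mx d *m z = y.
  apply/colP => i; rewrite mul_diag_mx mxE [z _ _]mxE.
  have [di|di] := eqVneq (d 0 i) 0; last by rewrite mulrC divfK.
  by rewrite di mul0r /y (eigenspace0_coord PP E0j).
exists (P^T *m z); first by rewrite -!mulmxA (mulmxA P) PP mul1mx dz mulmxA PtP mul1mx.
rewrite trmx_mul trmxK -(mulmxA z^T) -/y mxE.
transitivity (\sum_i y i 0 ^+ 2 / d 0 i).
  by apply: eq_bigr => i _; rewrite [z^T _ _]mxE [z _ _]mxE expr2 mulrAC.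
rewrite mulr_sumr.
transitivity (\sum_(k < r) \sum_(i | d 0 i == lambda k) y i 0 ^+ 2 / d 0 i); last first.
  apply: eq_bigr => k _; rewrite main_angle_sqr // -/y mulrA mulrA mulfV; last first.
    by rewrite pnatr_eq0 -lt0n.
  by rewrite mul1r mulr_suml; apply: eq_bigr => i /eqP ->.
rewrite (exchange_big_dep xpredT) //=; apply: eq_bigr => i _.
have [/existsP[k /eqP lk]|/existsP no_k] := boolP [exists k, lambda k == d 0 i].
  rewrite (big_pred1 k) // => k' /=.
  by rewrite -lk (inj_eq lambda_inj) eq_sym.
rewrite big_pred0 => [|k]; last first.
  by apply/negbTE/negP => /eqP dk; apply: no_k; exists k; rewrite dk.
suff -> : y i 0 = 0 by rewrite expr0n mul0r.
have : ~~ main_eigenvalue M (d 0 i).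
  by apply/negP => /lambdaP[k dk]; apply: no_k; exists k; apply/eqP.
rewrite negb_and negbK => /orP[/negP[]|].
  apply/eigenvalueP; exists (row i P).
    rewrite -row_mul M_def !mulmxA PP mul1mx.
    by apply/rowP => k; rewrite mul_diag_mx !mxE.
  apply/eqP => Pi0; have := congr1 (fun x => (row i x) 0 i) PP.
  by rewrite row_mul Pi0 mul0mx !mxE eqxx => /esym/eqP; rewrite oner_eq0.
rewrite -sqrf_eq0 M_def main_angle_sqr // mulf_eq0 invr_eq0 pnatr_eq0.
rewrite eqn0Ngt n_gt0 /= psumr_eq0 => [|k _]; last exact: sqr_ge0.
move=> /allP/(_ i (mem_index_enum i)); rewrite eqxx /= sqrf_eq0 => /eqP.
exact.
Qed.

(** * Signature of the centered matrix *)

Lemma signature_gowerF (R : realType) n (M : 'M[R]_n) l : M^T = M ->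
  signature (gowerF M l) = ((posidx (centered (- M) l))%:Z, (posidx (centered M l))%:Z).
Proof.
move=> M_sym; rewrite gowerFE signatureE ?opprK -?centeredN //.
by apply: centered_sym; rewrite linearN /= M_sym.
Qed.

Lemma posidx_eq_centered_succ (R : realType) n (M : 'M[R]_n) (w l : 'cV[R]_n) :
  M^T = M -> l^T *m onev = 1%:M -> M *m w = onev -> 0 <= (w^T *m onev) 0 0 ->
  posidx M = (posidx (centered M l)).+1.
Proof.
move=> M_sym l1 Mw c_ge0; apply/eqP; rewrite eqn_leq posidx_le_centered_succ //.
exact: posidx_centered_lt Mw c_ge0.
Qed.

Lemma posidx_eq_centered (R : realType) n (M : 'M[R]_n) (w l : 'cV[R]_n) :
  M^T = M -> l^T *m onev = 1%:M -> M *m w = onev -> (w^T *m onev) 0 0 < 0 ->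
  posidx M = posidx (centered M l).
Proof.
move=> M_sym l1 Mw c_lt0; apply/eqP; rewrite eqn_leq posidx_centered_le // andbT.
exact: posidx_le_centered Mw c_lt0.
Qed.

Theorem theorem3p2 (R : realType) (n : nat) (M : 'M[R]_n) (M_sym : M^T = M)
    (r : nat) (lambda : 'I_r -> R) (lambda_inj : injective lambda)
    (lambdaP : forall a : R,
        main_eigenvalue M a <-> exists i : 'I_r, lambda i = a)
    (beta : 'I_r -> R) (betaE : forall i, beta i = main_angle M (lambda i))
    (p q : int) (sigM : signature M = (p, q))
    (l : 'cV[R]_n) (l_sum1 : l^T *m onev = 1%:M) :
  let E0 := eigenspace M 0 in
  let j_perp := orthocomp onev^T in
  let s := \sum_(i < r) beta i ^+ 2 / lambda i in
  [/\ (E0 <= j_perp)%MS -> s = 0 ->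
        signature (gowerF M l) = (q - 1, p - 1),
      (E0 <= j_perp)%MS -> 0 < s ->
        signature (gowerF M l) = (q, p - 1),
      (E0 <= j_perp)%MS -> s < 0 ->
        signature (gowerF M l) = (q - 1, p)
    & ~~ (E0 <= j_perp)%MS ->
        signature (gowerF M l) = (q, p)].
Proof.
have NM_sym : (- M)^T = - M by rewrite linearN /= M_sym.
move=> E0 j_perp s; rewrite (signature_gowerF l M_sym).
move: sigM; rewrite signatureE // => - [<- <-].
have n_gt0 : 0 < n%:R :> R.
  rewrite ltr0n lt0n; apply/eqP => n0; move: l l_sum1; rewrite n0 => l.
  by move/matrixP/(_ 0 0)/eqP; rewrite !mxE big_ord0 eqxx eq_sym oner_eq0.
have preimage : (E0 <= j_perp)%MS -> exists w : 'cV[R]_n,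
    [/\ M *m w = onev, - M *m - w = onev, (w^T *m onev) 0 0 = n%:R * s
      & ((- w)^T *m onev) 0 0 = - (n%:R * s)].
  move=> /(onev_preimage M_sym lambda_inj lambdaP)[w Mw].
  have <- : s = \sum_(i < r) main_angle M (lambda i) ^+ 2 / lambda i.
    by apply: eq_bigr => i _; rewrite betaE.
  move=> ws; exists w; rewrite mulmxN mulNmx opprK.
  by split=> //; rewrite -ws linearN /= mulNmx mxE.
have predz k : (k.+1%:Z - 1) = k%:Z by rewrite intS addrAC subrr add0r.
split.
- move=> /preimage[w [Mw NMw ws Nws]] s0.
  rewrite (posidx_eq_centered_succ M_sym l_sum1 Mw) ?ws ?s0 ?mulr0 //.
  by rewrite (posidx_eq_centered_succ NM_sym l_sum1 NMw) ?Nws ?s0 ?mulr0 ?oppr0 // !predz.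
- move=> /preimage[w [Mw NMw ws Nws]] s_gt0.
  rewrite (posidx_eq_centered_succ M_sym l_sum1 Mw) ?ws ?mulr_ge0 // ?ltW //.
  by rewrite (posidx_eq_centered NM_sym l_sum1 NMw) ?Nws ?oppr_lt0 ?mulr_gt0 // !predz.
- move=> /preimage[w [Mw NMw ws Nws]] s_lt0.
  rewrite (posidx_eq_centered M_sym l_sum1 Mw) ?ws ?pmulr_rlt0 //.
  rewrite (posidx_eq_centered_succ NM_sym l_sum1 NMw) ?predz //.
  by rewrite Nws oppr_ge0 pmulr_rle0 // ltW.
rewrite sub_orthocomp trmxK => E0j.
have [i Ei] : exists i, (E0 *m onev) i 0 != 0.
  have [//|no_i] := boolP [exists i, (E0 *m onev) i 0 != 0]; first by move/existsP.
  case/eqP: E0j; apply/colP => i; rewrite [RHS]mxE; apply/eqP/negPn/negP => Ei.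
  by case/existsP: no_i; exists i.
(* A kernel vector with entries summing to one: for this choice of l both M and
   - M are equal to their centered matrices. *)
pose c := (row i E0 *m onev) 0 0.
have c_neq0 : c != 0 by rewrite /c -row_mul mxE.
pose u := c^-1 *: (row i E0)^T.
have u1 : u^T *m onev = 1%:M.
  rewrite linearZ /= trmxK -scalemxAl [row i E0 *m _]mx11_scalar -/c.
  by rewrite scale_scalar_mx mulVf.
have Mu : M *m u = 0.
  rewrite -scalemxAr -[in LHS]M_sym -trmx_mul.
  have /eigenspaceP -> : (row i E0 <= E0)%MS by apply: row_sub.
  by rewrite scale0r trmx0 scaler0.
have centered_kernel (A : 'M[R]_n) : A^T = A -> A *m u = 0 -> centered A u = A.
  move=> A_sym Au; rewrite (@centeredE _ _ _ _ 0) ?scale0r ?subr0 //.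
rewrite !(posidx_centered_indep _ l_sum1 u1) // !centered_kernel //.
by rewrite mulNmx Mu oppr0.
Qed.
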